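(* For every integer $n\ge 2$ and every even integer $d\ge 4$, $$\tfrac14 n^{d/2}-O(n^{d/2-1})\le \eta(P_n^d) < \sqrt{2d-2}\,n^{d/2}+3.$$
   Context: All graphs are finite, simple and undirected. $P_n$ is the path on $n$ vertices. The Cartesian product $G\,\square\,H$ has vertex set $V(G)\times V(H)$, with $(v,x)(w,y)$ an edge iff ($vw\in E(G)$ and $x=y$) or ($v=w$ and $xy\in E(H)$); $P_n^d$ is the $d$-fold Cartesian product $P_n\,\square\,\cdots\,\square\,P_n$. $\eta(G)$ is the maximum $k$ such that $K_k$ is a minor of $G$. The $O$-term is with respect to $n$ for fixed $d$. *)

(* Defs.v *)
From HB Require Import structures.
From mathcomp Require Import all_boot all_order all_algebra.
From mathcomp Require Import reals.

Set Implicit Arguments.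
Unset Strict Implicit.
Unset Printing Implicit Defensive.

Record sgraph := SGraph {
  vertex :> finType;
  adj : rel vertex;
  adj_sym : symmetric adj;
  adj_irrefl : irreflexive adj }.

Section PathGraph.
Variable n : nat.

Definition path_adj : rel 'I_n :=
  fun i j => (i.+1 == j :> nat) || (j.+1 == i :> nat).

Fact path_adj_sym : symmetric path_adj.
Proof. by move=> i j; rewrite /path_adj orbC. Qed.

Fact path_adj_irrefl : irreflexive path_adj.
Proof. by move=> i; rewrite /path_adj orbb gtn_eqF. Qed.

Definition path_graph : sgraph := SGraph path_adj_sym path_adj_irrefl.

End PathGraph.

Section CompleteGraph.
Variable k : nat.

Definition complete_adj : rel 'I_k := fun i j => i != j.

Fact complete_adj_sym : symmetric complete_adj.
Proof. by move=> i j; rewrite /complete_adj eq_sym. Qed.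

Fact complete_adj_irrefl : irreflexive complete_adj.
Proof. by move=> i; rewrite /complete_adj eqxx. Qed.

Definition complete_graph : sgraph :=
  SGraph complete_adj_sym complete_adj_irrefl.

End CompleteGraph.

Section CartesianProduct.
Variables G H : sgraph.

Definition cart_adj : rel (G * H)%type := fun u v =>
  (adj u.1 v.1 && (u.2 == v.2)) || ((u.1 == v.1) && adj u.2 v.2).

Fact cart_adj_sym : symmetric cart_adj.
Proof.
move=> u v; rewrite /cart_adj (adj_sym u.1) (adj_sym u.2).
by rewrite (eq_sym u.1) (eq_sym u.2).
Qed.

Fact cart_adj_irrefl : irreflexive cart_adj.
Proof. by move=> u; rewrite /cart_adj !adj_irrefl andbF. Qed.

Definition cart_prod : sgraph := SGraph cart_adj_sym cart_adj_irrefl.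

End CartesianProduct.

(* G [] (G [] (... [] G)) with d factors; the empty product is K_1. *)
Definition cart_pow (G : sgraph) (d : nat) : sgraph :=
  iterop d cart_prod G (complete_graph 1).

Definition connected_set (G : sgraph) (A : {set G}) : bool :=
  (A != set0) &&
  [forall x in A, forall y in A,
     connect (fun u v => [&& u \in A, v \in A & adj u v]) x y].

(* H is a minor of G: the vertices of H are represented by pairwise disjoint
   nonempty connected vertex sets of G (the branch sets, to be contracted),
   with an edge of G between the branch sets of any two adjacent vertices
   of H. *)
Definition is_minor (H G : sgraph) : bool :=
  [exists B : {ffun H -> {set G}},
    [&& [forall x, connected_set (B x)],
        [forall x, forall y, (x != y) ==> [disjoint B x & B y]]
      & [forall x, forall y, adj x y ==>
          [exists u in B x, exists v in B y, adj u v]]]].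

(* Branch sets are nonempty and disjoint, so restricting to k <= #|G| loses
   nothing: see hadwiger_max. *)
Definition hadwiger (G : sgraph) : nat :=
  \max_(k < #|G|.+1 | is_minor (complete_graph k) G) k.

Lemma minor_card (H G : sgraph) : is_minor H G -> #|H| <= #|G|.
Proof.
case/existsP=> B /and3P[/forallP conB /forallP disB _].
have neB x : exists v, v \in B x by apply/set0Pn; case/andP: (conB x).
pose f x := xchoose (neB x).
have fB x : f x \in B x by apply: xchooseP.
apply: (leq_card f) => x y eq_f; apply/eqP; apply: contraT => neq_xy.
move/forallP/(_ y)/implyP/(_ neq_xy): (disB x) => /pred0P/(_ (f x)).
by rewrite /= fB eq_f fB.
Qed.

Lemma hadwiger_minor (G : sgraph) : is_minor (complete_graph (hadwiger G)) G.
Proof.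
have K0 : is_minor (complete_graph (ord0 : 'I_#|G|.+1)) G.
  apply/existsP; exists [ffun=> set0].
  by apply/and3P; split; apply/forallP; case.
rewrite /hadwiger (bigmax_eq_arg ord0) //.
by case: arg_maxnP.
Qed.

Lemma hadwiger_max (G : sgraph) (k : nat) :
  is_minor (complete_graph k) G -> k <= hadwiger G.
Proof.
move=> minK; have := minor_card minK; rewrite card_ord => le_kG.
exact: (leq_bigmax_cond (Ordinal (le_kG : k < #|G|.+1))).
Qed.

(* Main.v *)
(* Lower bound.  Write the graph as [G [] G] with [G = P_n^(d/2)] and let [W] be
   a connected dominating set of [G].  For [u] outside [W] take the row [{u} x G]
   together with the column [W x {u}]: rows and columns never meet, and the row
   of [u] touches the column of [v] through a neighbour of [u] in [W].  This
   gives a complete minor on the complement of [W]; a comb with teeth in every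
   second layer leaves out about half of the vertices, more than the quarter
   required.
   Upper bound.  In maximum degree at most [2d], a connected branch set [B] has
   at most [(2d-2)|B| + 2] edges leaving it, and it needs [k-1] of them for a
   [K_k] minor.  Summing over the [k] branch sets, [k (k-3) <= (2d-2) n^d]. *)

Require Import Defs.
From mathcomp Require Import all_boot all_order all_algebra.
From mathcomp Require Import reals.
From mathcomp Require Import zify lra.
Import Order.TTheory GRing.Theory Num.Theory.

Set Implicit Arguments.
Unset Strict Implicit.
Unset Printing Implicit Defensive.

Local Open Scope nat_scope.

(** * Connected vertex sets *)

Definition induced_rel (G : sgraph) (A : {set G}) : rel G :=
  fun u v => [&& u \in A, v \in A & adj u v].

Lemma induced_sym (G : sgraph) (A : {set G}) : symmetric (induced_rel A).
Proof. by move=> u v; rewrite /induced_rel andbCA adj_sym. Qed.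

Lemma induced_connectC (G : sgraph) (A : {set G}) :
  connect_sym (induced_rel A).
Proof. exact/sym_connect_sym/induced_sym. Qed.

(** Since [induced_rel] is symmetric, any two vertices can be joined through one root. *)
Lemma connected_setP (G : sgraph) (A : {set G}) :
  reflect (exists2 r, r \in A & {in A, forall x, connect (induced_rel A) r x})
          (connected_set A).
Proof.
apply: (iffP andP) => [[/set0Pn[r rA] conA]|[r rA conA]].
  exists r => // x xA.
  by move/forall_inP/(_ r rA)/forall_inP/(_ x xA): conA.
split; first by apply/set0Pn; exists r.
apply/forall_inP=> x xA; apply/forall_inP=> y yA.
apply: (connect_trans (y := r)); last exact: conA.
rewrite (induced_connectC _ x); exact: conA.
Qed.

Lemma connect_in (G : sgraph) (A B : {set G}) (x y : G) :
  connected_set B -> B \subset A -> x \in B -> y \in B ->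
  connect (induced_rel A) x y.
Proof.
move=> /andP[_ /forall_inP conB] /subsetP sBA xB yB.
move/forall_inP/(_ y yB): (conB x xB); apply: connect_sub => u v.
case/and3P=> uB vB uv; apply: connect1.
by rewrite /induced_rel !sBA.
Qed.

Lemma connected_setU (G : sgraph) (A B : {set G}) (a b : G) :
  connected_set A -> connected_set B -> a \in A -> b \in B ->
  (a == b) || adj a b -> connected_set (A :|: B).
Proof.
move=> conA conB aA bB ab; apply/connected_setP.
exists a => [|x]; first by rewrite inE aA.
case/setUP=> [xA|xB]; first exact: connect_in conA (subsetUl _ _) aA xA.
apply: (connect_trans (y := b)).
  case/orP: ab => [/eqP->|ab]; first exact: connect0.
  by apply: connect1; rewrite /induced_rel !inE aA bB orbT.
exact: connect_in conB (subsetUr _ _) bB xB.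
Qed.

Definition graph_hom (G H : sgraph) (f : G -> H) :=
  forall u v, adj u v -> adj (f u) (f v).

Lemma connected_imset (G H : sgraph) (f : G -> H) (A : {set G}) :
  graph_hom f -> connected_set A -> connected_set (f @: A).
Proof.
move=> fP /connected_setP[r rA conA]; apply/connected_setP.
exists (f r) => [|_ /imsetP[x xA ->]]; first exact: imset_f.
case/connectP: (conA x xA) => p pP ->.
elim: p r pP {rA x xA conA} => [|y p IHp] r //= /andP[/and3P[rA yA ry] pP].
apply: connect_trans (IHp y pP); apply: connect1.
by rewrite /induced_rel !imset_f // fP.
Qed.

Lemma imset_pairl (S T : finType) (x : S) (B : {set T}) :
  pair x @: B = setX [set x] B.
Proof.
apply/setP=> -[y z]; rewrite !inE /=; apply/imsetP/andP.
  by case=> t tB [-> ->]; rewrite eqxx.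
by case=> /eqP-> zB; exists z.
Qed.

Lemma imset_pairr (S T : finType) (A : {set S}) (y : T) :
  (fun x => (x, y)) @: A = setX A [set y].
Proof.
apply/setP=> -[x z]; rewrite !inE /=; apply/imsetP/andP.
  by case=> t tA [-> ->]; rewrite eqxx.
by case=> xA /eqP->; exists x.
Qed.

(** * Connectivity and degrees in Cartesian products *)

Section Product.
Variables G H : sgraph.

Lemma pairl_hom (x : G) : graph_hom (pair x : H -> cart_prod G H).
Proof. by move=> u v uv; rewrite /= /cart_adj /= eqxx uv orbT. Qed.

Lemma pairr_hom (y : H) : graph_hom ((fun x => (x, y)) : G -> cart_prod G H).
Proof. by move=> u v uv; rewrite /= /cart_adj /= eqxx uv. Qed.

Lemma connected_setXl (x : G) (B : {set H}) :
  connected_set B -> connected_set (setX [set x] B : {set cart_prod G H}).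
Proof.
move=> /(connected_imset (pairl_hom x)).
by rewrite -(imset_pairl x B).
Qed.

Lemma connected_setXr (A : {set G}) (y : H) :
  connected_set A -> connected_set (setX A [set y] : {set cart_prod G H}).
Proof.
move=> /(connected_imset (pairr_hom y)).
by rewrite -(imset_pairr A y).
Qed.

(* A comb: a spine across the [G] direction with teeth in the [H] direction. *)
Lemma connected_comb (A : {set G}) (y : H) :
  connected_set [set: G] -> connected_set [set: H] ->
  connected_set (setX A setT :|: setX setT [set y] : {set cart_prod G H}).
Proof.
move=> conG conH.
have [r rG _] := connected_setP _ conG.
apply/connected_setP; exists (r, y) => [|[a z]]; first by rewrite !inE eqxx orbT.
move=> azW; apply: (connect_trans (y := (a, y))).
  by apply: connect_in (connected_setXr y conG) _ _ _;
    rewrite ?subsetUr ?inE ?eqxx.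
case/setUP: azW; last by rewrite !inE /= => /eqP->; apply: connect0.
rewrite !inE /= andbT => aA.
apply: connect_in (connected_setXl a conH) _ _ _; rewrite ?inE ?eqxx //.
apply/subsetP=> -[b t]; rewrite !inE /= !andbT => /eqP->.
by rewrite aA.
Qed.

(** The comb with a tooth at every vertex of [G] is the whole product. *)
Lemma connected_cart_prod :
  connected_set [set: G] -> connected_set [set: H] ->
  connected_set [set: cart_prod G H].
Proof.
move=> conG conH; have [y _ _] := connected_setP _ conH.
have := connected_comb setT y conG conH.
by congr connected_set; apply/setP=> u; rewrite !inE.
Qed.

Lemma nbrs_cart_prod (u : cart_prod G H) :
  #|[set v | adj u v]| = #|[set x | adj u.1 x]| + #|[set y | adj u.2 y]|.
Proof.
have -> : [set v | adj u v] = setX [set x | adj u.1 x] [set u.2]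
                          :|: setX [set u.1] [set y | adj u.2 y].
  apply/setP=> v; rewrite !inE /= /cart_adj.
  by rewrite (eq_sym u.2) (eq_sym u.1).
rewrite cardsU !cardsX !cards1 muln1 mul1n.
rewrite [X in _ - X](_ : _ = 0) ?subn0 //; apply/eqP; rewrite cards_eq0.
apply/eqP/setP=> v; rewrite !inE; apply/negP=> /andP[/andP[uv1 _] /andP[/eqP e _]].
by rewrite e adj_irrefl in uv1.
Qed.

End Product.

(** * Embeddings and monotonicity of the Hadwiger number *)

Definition embeds (G H : sgraph) := exists2 f : G -> H, injective f & graph_hom f.

Lemma embeds_refl (G : sgraph) : embeds G G.
Proof. by exists id. Qed.

Lemma embeds_trans (G H K : sgraph) : embeds G H -> embeds H K -> embeds G K.
Proof.
move=> [f fI fP] [g gI gP]; exists (g \o f); first exact: inj_comp.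
by move=> u v /fP/gP.
Qed.

Lemma embeds_prodA (G H K : sgraph) :
  embeds (cart_prod (cart_prod G H) K) (cart_prod G (cart_prod H K)).
Proof.
exists (fun u : cart_prod (cart_prod G H) K => (u.1.1, (u.1.2, u.2))).
  by move=> [[a b] c] [[a' b'] c'] [-> -> ->].
move=> [[a b] c] [[a' b'] c']; rewrite /= /cart_adj /= /cart_adj /=.
rewrite !xpair_eqE.
by do ![case: (adj _ _) | case: (_ == _)].
Qed.

Lemma embeds_prodr (G H K : sgraph) :
  embeds H K -> embeds (cart_prod G H) (cart_prod G K).
Proof.
move=> [f fI fP]; exists (fun u : cart_prod G H => (u.1, f u.2)).
  by move=> [a b] [a' b'] [-> /fI ->].
move=> [a b] [a' b']; rewrite /= /cart_adj /= => /orP[/andP[-> /eqP->]|].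
  by rewrite eqxx.
by case/andP=> -> /fP ->; rewrite orbT.
Qed.

Lemma cart_powS (G : sgraph) (d : nat) :
  cart_pow G d.+2 = cart_prod G (cart_pow G d.+1).
Proof. by []. Qed.

(** [cart_pow] nests to the right, so an even power is not literally a square [cart_prod G G]; this
    embedding carries minors of the square into the power. *)
Lemma embeds_cart_powD (G : sgraph) (a b : nat) :
  embeds (cart_prod (cart_pow G a.+1) (cart_pow G b.+1))
         (cart_pow G (a.+1 + b.+1)).
Proof.
elim: a => [|a IHa]; first exact: embeds_refl.
apply: embeds_trans (embeds_prodA _ _ _) _.
exact: embeds_prodr IHa.
Qed.

Lemma is_minor_embeds (K G H : sgraph) :
  embeds G H -> is_minor K G -> is_minor K H.
Proof.
move=> [f fI fP] /existsP[B /and3P[/forallP conB /forallP disB /forallP adjB]].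
apply/existsP; exists [ffun x => f @: B x]; apply/and3P; split.
- by apply/forallP=> x; rewrite ffunE connected_imset.
- apply/forallP=> x; apply/forallP=> y; apply/implyP=> xy.
  rewrite !ffunE -setI_eq0 -imsetI; last by move=> ? ? _ _; apply: fI.
  by move/forallP/(_ y)/implyP/(_ xy): (disB x); rewrite -setI_eq0 imset_eq0.
apply/forallP=> x; apply/forallP=> y; apply/implyP=> xy; rewrite !ffunE.
move/forallP/(_ y)/implyP/(_ xy): (adjB x).
case/exists_inP=> u uB /exists_inP[v vB uv].
by apply/exists_inP; exists (f u); rewrite ?imset_f //;
  apply/exists_inP; exists (f v); rewrite ?imset_f // fP.
Qed.

Lemma hadwiger_embeds (G H : sgraph) : embeds G H -> hadwiger G <= hadwiger H.
Proof.
by move=> GH; apply/hadwiger_max/(is_minor_embeds GH)/hadwiger_minor.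
Qed.

(** * Lower bound: rows and columns over a connected dominating set *)

Lemma hadwiger_dominating (G : sgraph) (W : {set G}) :
  connected_set [set: G] -> connected_set W ->
  (forall u, u \notin W -> exists2 w, w \in W & adj u w) ->
  #|~: W| <= hadwiger (cart_prod G G).
Proof.
move=> conG conW domW; apply: hadwiger_max; set k := #|~: W|.
pose g (i : 'I_k) : G := enum_val i.
have gW i : g i \notin W by have := enum_valP i; rewrite inE.
have gI : injective g by apply: enum_val_inj.
pose B i : {set cart_prod G G} := setX [set g i] setT :|: setX W [set g i].
apply/existsP; exists [ffun i => B i]; apply/and3P; split.
- apply/forallP=> i; rewrite ffunE; have [w wW uw] := domW _ (gW i).
  rewrite /B; apply: (@connected_setU (cart_prod G G) _ _ (g i, g i) (w, g i)).
  + exact: connected_setXl.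
  + exact: connected_setXr.
  + by rewrite !inE eqxx.
  + by rewrite !inE eqxx wW.
  by rewrite /= /cart_adj /= uw eqxx orbT.
- apply/forallP=> i; apply/forallP=> j; apply/implyP=> ij; rewrite !ffunE.
  rewrite -setI_eq0; apply/eqP/setP=> -[x y]; rewrite !inE /= !andbT.
  (* Two rows or two columns can only meet if [g i = g j]; a row meeting a column would put [g i] or
     [g j] into [W]. *)
  apply/negP=> /andP[/orP[/eqP xi|/andP[xW /eqP yi]] /orP[/eqP xj|/andP[xW' /eqP yj]]].
  + by case/eqP: ij; apply: gI; rewrite -xi.
  + by case/negP: (gW i); rewrite -xi.
  + by case/negP: (gW j); rewrite -xj.
  by case/eqP: ij; apply: gI; rewrite -yi.
apply/forallP=> i; apply/forallP=> j; apply/implyP=> ij; rewrite !ffunE.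
have [w wW uw] := domW _ (gW i).
apply/exists_inP; exists (g i, g j); first by rewrite !inE eqxx.
apply/exists_inP; exists (w, g j); first by rewrite !inE wW eqxx orbT.
by rewrite /= /cart_adj /= uw eqxx.
Qed.

Lemma connected_path_graph (n : nat) : connected_set [set: path_graph n.+1].
Proof.
apply/connected_setP; exists (ord0 : 'I_n.+1) => // -[i lt_in] _.
elim: i lt_in => [|i IHi] lt_in.
  by rewrite (_ : Ordinal lt_in = ord0) ?connect0 //; apply: val_inj.
apply: connect_trans (IHi (ltnW lt_in)) _; apply: connect1.
by rewrite /induced_rel !inE /= /path_adj /= eqxx.
Qed.

Lemma connected_cart_pow (G : sgraph) (d : nat) :
  connected_set [set: G] -> connected_set [set: cart_pow G d.+1].
Proof.
by move=> conG; elim: d => // d IHd; rewrite cart_powS connected_cart_prod.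
Qed.

Lemma card_cart_pow (G : sgraph) (d : nat) : #|cart_pow G d.+1| = #|G| ^ d.+1.
Proof. by elim: d => [|d IHd]; rewrite ?expn1 // cart_powS card_prod IHd -expnS. Qed.

Lemma card_odd_ord (n : nat) : #|[set i : 'I_n | odd i]| = n./2.
Proof.
rewrite -sum1_card (eq_bigl (fun i : 'I_n => odd i)) => [|i]; last by rewrite inE.
rewrite big_mkcond /=; elim: n => [|n IHn]; first by rewrite big_ord0.
by rewrite big_ord_recr /= IHn uphalf_half addnC; case: (odd n).
Qed.

Lemma hadwiger_path_pow_ge (n k : nat) :
  n.+1./2 * (n.+1 ^ k.+1 - 1)
    <= hadwiger (cart_pow (path_graph n.+1) (k.+2 + k.+2)).
Proof.
apply: leq_trans (hadwiger_embeds (embeds_cart_powD _ _ _)).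
rewrite cart_powS; set P := path_graph _; set H := cart_pow P _.
have conP : connected_set [set: P] := connected_path_graph n.
have conH : connected_set [set: H] := connected_cart_pow k conP.
have [y _ _] := connected_setP _ conH.
(* The teeth are the even layers: every odd layer has an even one just below it, whatever the parity
   of the length. The complement is the odd layers with the spine point [y] removed. *)
pose W : {set cart_prod P H} :=
  setX [set i : P | ~~ odd (i : 'I__)] setT :|: setX setT [set y].
have -> : n.+1./2 * (n.+1 ^ k.+1 - 1) = #|~: W|.
  have -> : ~: W = setX [set i : P | odd (i : 'I__)] [set~ y].
    apply/setP=> -[i z]; rewrite !inE /= andbT negb_or negbK.
    by [].
  rewrite cardsX card_odd_ord cardsC1 card_cart_pow card_ord subn1.
  by [].
apply: hadwiger_dominating; first exact: connected_cart_prod.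
  exact: connected_comb.
move=> [[i lt_in] z]; rewrite !inE /= andbT negb_or negbK => /andP[odd_i _].
case: i lt_in odd_i => // i lt_in /= odd_i.
exists ((Ordinal (ltnW lt_in) : P), z); first by rewrite !inE /= odd_i.
by rewrite /= /cart_adj /= eqxx andbT /path_adj /= eqxx orbT.
Qed.

(** * Upper bound: counting edges at the branch sets *)

Lemma induced_edges (G : sgraph) (A : {set G}) :
  connected_set A -> 2 * #|A| <= \sum_(v in A) #|[set w in A | adj v w]| + 2.
Proof.
move=> conA; have /andP[A0 /forall_inP conAP] := conA.
have A_gt0 : 0 < #|A| by rewrite card_gt0.
pose e (S : {set G}) := \sum_(v in S) #|[set w in S | adj v w]|.
(* The sum counts inner edges twice, so the claim is that [A] spans at least [#|A| - 1] edges. [S]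
   grows by one vertex at a time; connectivity of [A] alone supplies an edge leaving [S]. *)
suff grow m : 0 < m <= #|A| ->
    exists S : {set G}, [/\ S \subset A, #|S| = m & 2 * m <= e S + 2].
  have [S [sSA cardS eS]] := grow #|A| (introT andP (conj A_gt0 (leqnn _))).
  suff /eqP <- : S == A by rewrite cardS.
  by rewrite eqEcard sSA cardS leqnn.
elim: m => // -[_ _|m IHm /andP[_ lt_mA]].
  have /set0Pn[r rA] := A0.
  by exists [set r]; rewrite sub1set cards1 rA muln1 leq_addl.
have [S [sSA cardS eS]] := IHm (ltnW lt_mA).
have [y yA yS] : exists2 y, y \in A & y \notin S.
  apply/subsetPn; apply: contraL lt_mA => /subset_leq_card.
  by rewrite cardS -leqNgt.
have /set0Pn[x xS] : S != set0 by rewrite -card_gt0 cardS.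
have xA := subsetP sSA x xS.
have [v [w [vS wA wS vw]]] :
    exists v w, [/\ v \in S, w \in A, w \notin S & adj v w].
  suff /existsP[v /existsP[w /and4P[]]] :
      [exists v, exists w, [&& v \in S, w \in A, w \notin S & adj v w]].
    by exists v, w.
  (* Without an edge from [S] to the rest of [A], [S] would be closed under [induced_rel A], and the
     path from [x] could not reach [y]. *)
  apply: contraNT yS => noedge.
  have cl : closed (induced_rel A) (mem S).
    apply: (intro_closed (@induced_connectC G A)) => v w /and3P[_ wA vw] vS.
    apply: contraNT noedge => wS.
    by apply/existsP; exists v; apply/existsP; exists w; apply/and4P.
  move/forall_inP/(_ y yA): (conAP x xA) => /(closed_connect cl).
  by rewrite xS => <-.
exists (w |: S); split; first by rewrite subUset sub1set wA.
  by rewrite cardsU1 wS cardS.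
have degS z : #|[set t in S | adj z t]| <= #|[set t in w |: S | adj z t]|.
  apply/subset_leq_card/subsetP=> t; rewrite !inE => /andP[-> ->].
  by rewrite orbT.
(* The new edge [vw] is counted once at [v] and once at [w], which pays for the increase of [2 * m]
   by 2. *)
have degv : #|[set t in S | adj v t]| < #|[set t in w |: S | adj v t]|.
  apply/proper_card/properP; split.
    apply/subsetP=> t; rewrite !inE => /andP[-> ->]; by rewrite orbT.
  by exists w; rewrite !inE ?eqxx ?vw // (negbTE wS).
have degw : 0 < #|[set t in w |: S | adj w t]|.
  by apply/card_gt0P; exists v; rewrite !inE vS adj_sym vw orbT.
rewrite /e big_setU1 //=; move: eS; rewrite /e.
rewrite (bigD1 v) //= [X in _ -> _ <= _ + X + _](bigD1 v) //=.
have : \sum_(z in S | z != v) #|[set t in S | adj z t]|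
       <= \sum_(z in S | z != v) #|[set t in w |: S | adj z t]|.
  by apply: leq_sum => z _; apply: degS.
move=> le_s eS; rewrite mulnS add2n.
apply: leq_trans (leq_add (leq_add degw (leq_add degv le_s)) (leqnn 2)).
by rewrite add1n !addSn !ltnS.
Qed.

Lemma boundary_edges (G : sgraph) (A : {set G}) :
  #|[set w in ~: A | [exists v in A, adj v w]]|
    <= \sum_(v in A) #|[set w in ~: A | adj v w]|.
Proof.
have -> : [set w in ~: A | [exists v in A, adj v w]]
        = \bigcup_(v in A) [set w in ~: A | adj v w].
  apply/setP=> w; rewrite !inE; apply/andP/bigcupP.
    by case=> wA /exists_inP[v vA vw]; exists v; rewrite ?inE ?wA.
  case=> v vA; rewrite !inE => /andP[-> vw]; split=> //.
  by apply/exists_inP; exists v.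
apply: (big_rec2 (fun (X : {set G}) m => #|X| <= m)); first by rewrite cards0.
move=> v m X _ leXm; apply: leq_trans (leq_card_setU _ _) _.
by rewrite leq_add2l.
Qed.

(* Double counting of the degree sum over [A]: a spanning tree inside, the
   boundary outside. *)
Lemma boundary_le (G : sgraph) (D : nat) (A : {set G}) :
  (forall v : G, #|[set w | adj v w]| <= D.+2) -> connected_set A ->
  #|[set w in ~: A | [exists v in A, adj v w]]| <= D * #|A| + 2.
Proof.
move=> degD conA; have := induced_edges conA; have := boundary_edges A.
have : \sum_(v in A) (#|[set w in A | adj v w]| + #|[set w in ~: A | adj v w]|)
       <= \sum_(v in A) D.+2.
  apply: leq_sum => v _; apply: leq_trans (degD v).
  rewrite -(cardsID A [set w | adj v w]) leq_eqVlt; apply/orP; left.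
  by apply/eqP; congr (_ + _); apply: eq_card => w; rewrite !inE // andbC.
(* Of a degree sum of at most [(D + 2) * #|A|], inner edges take at least [2 * #|A| - 2]. *)
rewrite big_split /= sum_nat_const; nia.
Qed.

Lemma complete_minor_bound (G : sgraph) (D k : nat) :
  (forall v : G, #|[set w | adj v w]| <= D.+2) ->
  is_minor (complete_graph k) G -> k ^ 2 <= D * #|G| + 3 * k.
Proof.
rewrite -mulnn => degD /existsP[B /and3P[/forallP conB /forallP disB /forallP adjB]].
have disjB x y : x != y -> B x :&: B y = set0.
  move=> xy; apply/eqP; rewrite setI_eq0.
  by move/forallP/(_ y)/implyP/(_ xy): (disB x).
(* Each of the other [k - 1] branch sets contains a boundary vertex of [B x], and disjointness makes
   these vertices distinct. *)
have lek x : k <= D * #|B x| + 3.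
  rewrite (_ : 3 = 2 + 1) // addnA addn1; apply: leq_trans (_ : k.-1.+1 <= _).
    exact: leqSpred.
  rewrite ltnS; apply: leq_trans (boundary_le degD (conB x)).
  have -> : k.-1 = #|[set~ x]| by rewrite cardsC1 card_ord.
  have exw y : y != x -> exists w, (w \in B y) && [exists v in B x, adj v w].
    rewrite eq_sym => xy; move/forallP/(_ y)/implyP/(_ xy): (adjB x).
    case/exists_inP=> v vB /exists_inP[w wB vw]; exists w.
    by rewrite wB; apply/exists_inP; exists v.
  (* The default, a vertex of [B x], only makes [f] total; for [y != x] the search succeeds by
     [exw]. *)
  pose f y := odflt (xchoose (set0Pn _ (andP (conB x)).1))
                [pick w | (w \in B y) && [exists v in B x, adj v w]].
  have fP y : y \in [set~ x] -> (f y \in B y) && [exists v in B x, adj v (f y)].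
    rewrite !inE => /exw[w wP]; rewrite /f; case: pickP => // /(_ w).
    by rewrite wP.
  rewrite -(card_in_imset (f := f)).
    apply/subset_leq_card/subsetP=> _ /imsetP[y yx ->].
    have /andP[fy fx] := fP y yx; rewrite !inE fx andbT.
    rewrite !inE in yx; have /setP/(_ (f y)) := disjB _ _ yx.
    by rewrite !inE fy /= => ->.
  move=> y z /fP/andP[fy _] /fP/andP[fz _] eq_f.
  apply/eqP; apply: contraT => /disjB/setP/(_ (f y)).
  by rewrite !inE fy eq_f fz.
have sumB : \sum_x #|B x| <= #|G|.
  rewrite -sum1_card; under eq_bigr do rewrite -sum1_card.
  rewrite (exchange_big_dep xpredT) //=; apply: leq_sum => v _.
  have [x xv | nov] := pickP (fun x => v \in B x); last by rewrite big_pred0.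
  rewrite (big_pred1 x) // => y; apply/idP/eqP => [yv|->//].
  apply/eqP; apply: contraT => /disjB/setP/(_ v).
  by rewrite !inE xv yv.
have : \sum_(x < k) k <= \sum_(x < k) (D * #|B x| + 3).
  by apply: leq_sum => x _; apply: lek.
rewrite sum_nat_const card_ord big_split /= sum_nat_const card_ord -big_distrr /=.
move/leq_trans; apply.
by rewrite [3 * k]mulnC leq_add2r leq_mul2l sumB orbT.
Qed.

Lemma path_graph_degree (n : nat) (i : path_graph n) :
  #|[set j | adj i j]| <= 2.
Proof.
rewrite cardE -(size_map val).
(* Neighbours are compared as naturals: the successor may lie outside the path and the truncated
   predecessor of 0 is 0, which is harmless for an inclusion. *)
apply: (@uniq_leq_size _ _ [:: (i : 'I_n).+1; (i : 'I_n).-1]).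
  by rewrite map_inj_uniq ?enum_uniq //; apply: val_inj.
move=> t /mapP[j]; rewrite mem_enum inE => ij ->; rewrite !inE.
case/orP: ij => /eqP ij; apply/orP; [left|right]; apply/eqP.
  exact: esym.
exact: (congr1 predn ij).
Qed.

Lemma cart_pow_degree (G : sgraph) (D d : nat) :
  (forall v : G, #|[set w | adj v w]| <= D) ->
  forall v : cart_pow G d.+1, #|[set w | adj v w]| <= D * d.+1.
Proof.
move=> degD; elim: d => [|d IHd]; first by rewrite muln1.
by rewrite cart_powS => v; rewrite nbrs_cart_prod mulnS leq_add.
Qed.

Lemma hadwiger_path_pow_le (n d : nat) :
  hadwiger (cart_pow (path_graph n) d.+1) ^ 2
    <= 2 * d * n ^ d.+1 + 3 * hadwiger (cart_pow (path_graph n) d.+1).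
Proof.
have <- : #|cart_pow (path_graph n) d.+1| = n ^ d.+1.
  by rewrite card_cart_pow card_ord.
apply: complete_minor_bound (hadwiger_minor _) => v.
(* The dimension is [d.+1], so the factor [2 * d] is twice the dimension minus 2. *)
have -> : (2 * d).+2 = 2 * d.+1 by rewrite mulnS.
by apply: cart_pow_degree; apply: path_graph_degree.
Qed.

(** * Passage to real estimates *)

Local Open Scope ring_scope.

Theorem mainTheorem6 (R : realType) (d : nat)
    (hd4 : (4 <= d)%N) (hd : ~~ odd d) :
  (exists C : R, forall n : nat, (2 <= n)%N ->
     1 / 4 * n%:R ^+ d./2 - C * n%:R ^+ (d./2 - 1)
       <= (hadwiger (cart_pow (path_graph n) d))%:R) /\
  (forall n : nat, (2 <= n)%N ->
     (hadwiger (cart_pow (path_graph n) d))%:R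
       < Num.sqrt (2 * d%:R - 2 : R) * n%:R ^+ d./2 + 3).
Proof.
have [k ->] : exists k, d = (k.+2 + k.+2)%N by exists d./2.-2; lia.
rewrite addnn doubleK -addnn subn1 /=; split.
  (* With [x] the side length, [p = x ^ (k + 1)] and [h] the half of [x] rounded down,
     [h (p - 1) >= (x - 1)(p - 1) / 2], and [x <= p] makes this at least [x p / 4 - p]. *)
  exists 1 => -[|n] // n_gt1.
  have := hadwiger_path_pow_ge n k; rewrite -(ler_nat R); apply: le_trans.
  rewrite natrM natrB ?expn_gt0 // natrX exprS.
  have le_half : (n.+1%:R - 1 : R) <= 2 * (n.+1./2)%:R.
    by rewrite lerBlDr -natrM natr1 ler_nat; lia.
  have n_ge2 : (2 : R) <= n.+1%:R by rewrite ler_nat.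
  have le_pow : n.+1%:R <= n.+1%:R ^+ k.+1 :> R.
    by rewrite exprS ler_peMr ?ler0n // exprn_ege1 // ler1n.
  move: le_half n_ge2 le_pow.
  move: (n.+1%:R) (_ ^+ k.+1) (n.+1./2%:R) => x p h le_half n_ge2 le_pow.
  have : (x - 1) * (p - 1) <= 2 * h * (p - 1).
    by apply: ler_wpM2r => //; lra.
  have : 0 <= x * p by apply: mulr_ge0; lra.
  lra.
move=> n n_gt1.
have := hadwiger_path_pow_le n (k + k.+2).+1.
rewrite -!addSn; set m := hadwiger _ => le_m.
set s := Num.sqrt _; pose p : R := n%:R ^+ k.+2.
have s_gt0 : 0 < s.
  rewrite sqrtr_gt0 natrD mulrDr -natrM.
  have : (2 : R) <= k.+2%:R by rewrite ler_nat.
  lra.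
have p_gt0 : 0 < p by rewrite exprn_gt0 // ltr0n; lia.
have sp_gt0 : 0 < s * p by rewrite mulr_gt0.
(* Here [(s * p) ^ 2] is [(2d - 2) n^d]. *)
have : m%:R ^+ 2 <= (s * p) ^+ 2 + 3 * m%:R.
  move: le_m; rewrite -(ler_nat R) natrD natrX (natrM _ _ (n ^ _)) natrX (natrM _ 3) => /le_trans; apply.
  rewrite lerD2r exprMn sqr_sqrtr; last first.
    by move: s_gt0; rewrite sqrtr_gt0 => /ltW.
  rewrite /p -exprM.
  rewrite (_ : (k.+2 * 2 = k.+2 + k.+2)%N); last by lia.
  rewrite ler_wpM2r ?exprn_ge0 //.
  by rewrite natrM !natrD -!natr1; lra.
(* If [m >= s p + 3], then [m (m - 3) >= (s p + 3) s p > (s p)^2], against [le_mm]. *)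
rewrite -/p => le_mm; case: (ltP m%:R (s * p + 3)) => // ge_m.
have : s * p * s * p < m%:R * (m%:R - 3) by nra.
nra.
Qed.
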